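(* Let $T$ be an $r$-ary GDH theory and let $\mathcal{F}$ be an infinite family of $T$-graphs. For each $\epsilon > 0$ there exists a finite subfamily $\mathcal{F}_\epsilon \subset \mathcal{F}$ such that \[\text{ex}_T(n,\mathcal{F}) \leq \text{ex}_T(n,\mathcal{F}_\epsilon) < \text{ex}_T(n,\mathcal{F}) + \epsilon n^r\] for all sufficiently large $n$.
   Context: For an integer $r \geq 2$ and a subgroup $J_T \subseteq S_r$, the GDH theory $T$ has $m_T := |J_T|$. A $T$-graph $G$ is a finite set $V_G$ with a relation $E_G \subseteq V_G^r$ such that every tuple in $E_G$ has pairwise distinct entries and $E_G$ is closed under permuting coordinates by elements of $J_T$. An edge is an orbit of $E_G$ under this $J_T$-action. A copy of $H$ in $G$ is an injective map $V_H \to V_G$ sending every tuple of $E_H$ to a tuple of $E_G$; $G$ is $\mathcal{F}$-free if it contains no copy of any member of $\mathcal{F}$. $\text{ex}_T(n,\mathcal{F})$ is the maximum number of edges in an $\mathcal{F}$-free $T$-graph on $n$ vertices. *)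

(* Defs.v *)
From HB Require Import structures.
From mathcomp Require Import all_boot all_fingroup.
From mathcomp Require Import boolp.

Set Implicit Arguments.
Unset Strict Implicit.
Unset Printing Implicit Defensive.

Section CoordinateAction.

Variables (r : nat) (V : finType).

(* The inverse makes this a right action for the composition order of 'S_r,
   where (s * t) i = t (s i); the orbits under a subgroup do not depend on it. *)
Definition perm_coords (x : {ffun 'I_r -> V}) (s : 'S_r) : {ffun 'I_r -> V} :=
  [ffun i => x (s^-1 i)%g].

Fact perm_coords1 : perm_coords^~ 1%g =1 id.
Proof. by move=> x; apply/ffunP => i; rewrite ffunE invg1 perm1. Qed.

Fact perm_coordsM x : act_morph perm_coords x.
Proof. by move=> s t; apply/ffunP => i; rewrite !ffunE invMg permM. Qed.

Definition coord_act : {action 'S_r &-> {ffun 'I_r -> V}} :=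
  TotalAction perm_coords1 perm_coordsM.

End CoordinateAction.

Section TGraphs.

Variables (r : nat) (J : {group 'S_r}).

Definition tgraph_axiom (V : finType) (E : {set {ffun 'I_r -> V}}) : bool :=
  [forall x in E, injectiveb x] &&
  [forall x in E, forall s in J, coord_act r V x s \in E].

(* Structures on a fixed vertex set, kept apart from [tgraph] so that they form
   a finite type. *)
Record tgraph_on (V : finType) := TGraphOn {
  tuples :> {set {ffun 'I_r -> V}};
  _ : tgraph_axiom tuples }.

HB.instance Definition _ (V : finType) := [isSub for @tuples V].
HB.instance Definition _ (V : finType) := [Finite of tgraph_on V by <:].

Record tgraph := TGraph {
  vertices : finType;
  structure : tgraph_on vertices }.

Definition edges (V : finType) (G : tgraph_on V) : {set {set {ffun 'I_r -> V}}} :=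
  [set orbit (coord_act r V) J x | x in tuples G].

(* Families are predicates rather than [set]s: [classical_sets.set] only accepts
   types strictly below the universe of [finType], hence not [tgraph], and so
   [cardinality.finite_set] does not apply either. *)
Definition finite_family (F : tgraph -> Prop) : Prop :=
  exists (k : nat) (s : 'I_k -> tgraph),
    forall H : tgraph, F H <-> exists i : 'I_k, H = s i.

Definition is_copy (V W : finType) (H : tgraph_on V) (G : tgraph_on W)
    (f : V -> W) : Prop :=
  injective f /\
  forall x : {ffun 'I_r -> V}, x \in tuples H -> [ffun i => f (x i)] \in tuples G.

Definition family_free (F : tgraph -> Prop) (W : finType) (G : tgraph_on W) : Prop :=
  forall H : tgraph, F H ->
  ~ exists f : vertices H -> W, is_copy (structure H) G f.

(* The maximum is over T-graphs with vertex set 'I_n; [ex_T_bound] and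
   [ex_T_attained] show that it is the maximum over all T-graphs with n vertices.
   It is 0 if none of them is F-free, which requires an edgeless member of F
   on at most n vertices. *)
Definition ex_T (n : nat) (F : tgraph -> Prop) : nat :=
  \max_(G : tgraph_on 'I_n | `[< family_free F G >]) #|edges G|.

Lemma ex_T_attained n F (G0 : tgraph_on 'I_n) : family_free F G0 ->
  exists2 G : tgraph_on 'I_n, family_free F G & #|edges G| = ex_T n F.
Proof.
move=> /asboolP G0F; rewrite /ex_T (bigmax_eq_arg G0) //.
by case: arg_maxnP => // G /asboolP GF _; exists G.
Qed.

Lemma ex_T_bound (n : nat) (F : tgraph -> Prop) (W : finType) (G : tgraph_on W) :
  #|W| = n -> family_free F G -> (#|edges G| <= ex_T n F)%N.
Proof.
move=> <- GF.
pose h (x : {ffun 'I_r -> W}) : {ffun 'I_r -> 'I_#|W|} :=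
  [ffun i => enum_rank (x i)].
have hinj : injective h.
  by move=> x y /ffunP e; apply/ffunP => i; apply: enum_rank_inj;
    have := e i; rewrite !ffunE.
have hact x s : coord_act r _ (h x) s = h (coord_act r _ x s).
  by apply/ffunP => i; rewrite !ffunE.
have ax : tgraph_axiom (h @: tuples G).
  have /andP[/forall_inP i1 /forall_inP i2] : tgraph_axiom (tuples G) by case: (G).
  apply/andP; split; apply/forall_inP => _ /imsetP[x xG ->].
    apply/injectiveP => i j; rewrite !ffunE => /enum_rank_inj.
    by move/injectiveP: (i1 _ xG); apply.
  apply/forall_inP => s sJ; rewrite hact; apply: imset_f.
  by move/forall_inP: (i2 _ xG); apply.
pose G' : tgraph_on 'I_#|W| := TGraphOn ax.
have G'F : family_free F G'.
  move=> H FH [f [fi fE]]; apply: (GF H FH).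
  exists (fun v => enum_val (f v)); split; first by move=> u v /enum_val_inj/fi.
  move=> x /fE /imsetP[y yG e].
  suff -> : [ffun i => enum_val (f (x i))] = y by [].
  apply/ffunP => i; move/ffunP/(_ i): e; rewrite !ffunE => ->.
  by rewrite enum_rankK.
have -> : #|edges G| = #|edges G'|.
  have -> : edges G' = (fun A : {set _} => h @: A) @: edges G.
    rewrite /edges /= -!imset_comp; apply: eq_imset => x /=.
    by rewrite /orbit -imset_comp; apply: eq_imset => s; rewrite /= -hact.
  by rewrite [RHS]card_imset //; apply: imset_inj.
by apply: leq_bigmax_cond; apply/asboolP.
Qed.

End TGraphs.

(* Main.v *)
Require Import Defs.
From mathcomp Require Import all_boot all_order all_algebra all_fingroup.
From mathcomp Require Import boolp reals.
Import Order.TTheory GRing.Theory Num.Theory.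
Local Open Scope ring_scope.

(** The density [ex_T n F / 'C(n, r)] is nonincreasing in [n], since the edges
    avoiding a vertex span an [F]-free graph on one vertex fewer; so it is within
    [eps] of its limit at some [m]. Choosing, for each of the finitely many graphs
    on ['I_m] that are not [F]-free, one member of [F] that embeds in it gives a
    finite subfamily with the same extremal number at [m], whose own density is
    nonincreasing too. *)

Section InducedGraph.

Context {r : nat} {J : {group 'S_r}} {W : finType} (G : tgraph_on J W).
Context (A : {set W}).

Definition ffun_val (x : {ffun 'I_r -> {w | w \in A}}) : {ffun 'I_r -> W} :=
  [ffun i => val (x i)].

Lemma ffun_val_act x s :
  coord_act r W (ffun_val x) s = ffun_val (coord_act r _ x s).
Proof. by apply/ffunP => i; rewrite !ffunE. Qed.

Lemma induced_axiom : tgraph_axiom J (ffun_val @^-1: tuples G).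
Proof.
have /andP[/forall_inP i1 /forall_inP i2] : tgraph_axiom J (tuples G) by case: (G).
apply/andP; split; apply/forall_inP => x; rewrite inE => xG.
  apply/injectiveP => i j e; move/injectiveP: (i1 _ xG); apply.
  by rewrite !ffunE e.
apply/forall_inP => s sJ; rewrite inE -ffun_val_act.
by move/forall_inP: (i2 _ xG); apply.
Qed.

Definition induced : tgraph_on J {w | w \in A} := TGraphOn induced_axiom.

(** Composing with [val] turns a copy in the induced graph into a copy in [G]. *)
Lemma induced_free (F : tgraph J -> Prop) : family_free F G -> family_free F induced.
Proof.
move=> GF H FH [f [fi fE]]; case: (GF H FH).
exists (fun v => val (f v)); split; first by move=> u v /val_inj/fi.
move=> x xH; have := fE x xH; rewrite inE => xG.
rewrite (_ : finfun _ = ffun_val [ffun i => f (x i)]) //.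
by apply/ffunP => i; rewrite !ffunE.
Qed.

Definition edges_in : {set {set {ffun 'I_r -> W}}} :=
  [set e in edges G | [forall x in e, forall i, x i \in A]].

(** The action only permutes coordinates, so all tuples of an edge have the same entries and one
    representative decides. *)
Lemma orbit_inE (y : {ffun 'I_r -> W}) :
  [forall x in orbit (coord_act r W) J y, forall i, x i \in A]
  = [forall i, y i \in A].
Proof.
apply/forall_inP/forallP => [/(_ _ (orbit_refl _ _ _))/forallP //|yA x].
by case/orbitP => s _ <-; apply/forallP => i; rewrite ffunE.
Qed.

(** [ffun_val] commutes with the action, so it maps orbits to orbits, and every edge inside [A] is
    the image of an edge of [induced]. *)
Lemma card_edges_in_le : (#|edges_in| <= #|edges induced|)%N.
Proof.
pose h (e : {set {ffun 'I_r -> {w | w \in A}}}) := ffun_val @: e.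
apply: (leq_trans _ (leq_imset_card h _)); apply/subset_leq_card/subsetP => e.
rewrite inE => /andP[/imsetP[y yG ->]]; rewrite orbit_inE => /forallP yA.
pose x : {ffun 'I_r -> {w | w \in A}} := [ffun i => exist _ (y i) (yA i)].
have yx : y = ffun_val x by apply/ffunP => i; rewrite !ffunE.
apply/imsetP; exists (orbit (coord_act r _) J x).
  by apply/imsetP; exists x; rewrite // inE -yx.
by rewrite yx /h /orbit -imset_comp; apply: eq_imset => s /=; rewrite -ffun_val_act.
Qed.

End InducedGraph.

(** Double counting of pairs of an edge and a vertex off it: tuples of an edge are injective, so
    each edge misses exactly [#|W| - r] vertices. *)
Lemma sum_card_edges_avoiding {r : nat} {J : {group 'S_r}} {W : finType}
    (G : tgraph_on J W) :
  (\sum_(v : W) #|edges_in G [set~ v]| = #|edges G| * (#|W| - r))%N.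
Proof.
under eq_bigr => v _ do rewrite -sum1dep_card.
rewrite (exchange_big_dep (mem (edges G))) /=; last by move=> v e _ /andP[].
rewrite -sum_nat_const; apply: eq_bigr => e eG.
have /imsetP[y yG ->] := eG.
have /andP[/forall_inP/(_ _ yG)/injectiveP yi _] :
  tgraph_axiom J (tuples G) by case: (G).
(* Here [r] becomes the size of [codom y], and [#|W|] splits into [codom y] and its complement. *)
rewrite sum1dep_card -[X in (_ - X)%N](card_ord r) -(card_codom yi)
  -(cardC [in codom y]).
rewrite addKn; apply: eq_card => v; rewrite !inE (_ : _ \in _ = true) //=.
  rewrite orbit_inE; apply/forallP/idP => [yv|/negP yv i].
    by apply/negP => /codomP[i vi]; have := yv i; rewrite !inE vi eqxx.
  by rewrite !inE; apply/eqP => e1; apply: yv; rewrite -e1 codom_f.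
by apply: imset_f.
Qed.

(** Sum over all vertices [v] of an extremal graph on [n.+1] vertices: deleting [v] leaves at most
    [ex_T n F] edges. *)
Lemma ex_T_delete {r : nat} {J : {group 'S_r}} (F : tgraph J -> Prop) (n : nat) :
  ((n.+1 - r) * ex_T n.+1 F <= n.+1 * ex_T n F)%N.
Proof.
have [[G0 G0F]|noG] := pselect (exists G : tgraph_on J 'I_n.+1, family_free F G);
  last first.
  (* The maximum over no graphs is 0. *)
  rewrite {1}/ex_T big_pred0 ?muln0 // => G; apply/negbTE/asboolP => GF.
  by apply: noG; exists G.
have [G GF <-] := ex_T_attained G0F.
have := sum_card_edges_avoiding G; rewrite card_ord mulnC => <-.
rewrite -[X in (_ <= X * _)%N]card_ord -sum_nat_const; apply: leq_sum => v _.
(* [ex_T_bound] accepts any vertex type with [n] elements, so the induced graph needs no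
   relabelling. *)
apply: leq_trans (card_edges_in_le _ _) (ex_T_bound _ (induced_free _ _ _ GF)).
by rewrite card_sig -[n in RHS]/(n.+1.-1) -[n.+1 in RHS]card_ord -(cardsC1 v).
Qed.

(** An [r]-set can carry up to [r! / #|J|] edges, so this is the usual edge density up to that
    constant factor and may exceed 1. *)
Definition ex_density (R : realType) {r : nat} {J : {group 'S_r}}
    (F : tgraph J -> Prop) (n : nat) : R := (ex_T n F)%:R / 'C(n, r)%:R.

(** After clearing denominators and multiplying by [n.+1 - r], the identity [(n.+1 - r) * 'C(n.+1,
    r) = n.+1 * 'C(n, r)] reduces this to [ex_T_delete]. *)
Lemma ex_densityS (R : realType) {r : nat} {J : {group 'S_r}}
    (F : tgraph J -> Prop) (n : nat) : (r <= n)%N ->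
  ex_density R F n.+1 <= ex_density R F n.
Proof.
move=> rn; have rn1 := leqW rn.
rewrite /ex_density ler_pdivrMr ?ltr0n ?bin_gt0 // mulrAC.
rewrite ler_pdivlMr ?ltr0n ?bin_gt0 // -!natrM ler_nat.
have nr : (0 < n.+1 - r)%N by rewrite subn_gt0.
rewrite -(leq_pmul2l nr) mulnA [leqRHS]mulnCA -mul_bin_down /=.
by rewrite [leqRHS]mulnCA mulnA leq_mul2r ex_T_delete orbT.
Qed.

Lemma ex_density_le (R : realType) {r : nat} {J : {group 'S_r}}
    (F : tgraph J -> Prop) (m n : nat) : (r <= m)%N -> (m <= n)%N ->
  ex_density R F n <= ex_density R F m.
Proof.
move=> rm; elim: n => [|n IHn]; first by rewrite leqn0 => /eqP ->.
rewrite leq_eqVlt => /orP[/eqP -> //|]; rewrite ltnS => mn.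
exact: le_trans (ex_densityS R F n (leq_trans rm mn)) (IHn mn).
Qed.

Lemma ex_density_stable (R : realType) {r : nat} {J : {group 'S_r}}
    (F : tgraph J -> Prop) (eps : R) : 0 < eps ->
  exists2 m, (r <= m)%N & forall n, (r <= n)%N ->
    ex_density R F m < ex_density R F n + eps.
Proof.
move=> eps0.
(* The infimum stands in for the limit. Only [n] with [r <= n] enter: below [r] the denominator is 0
   and the quotient is 0 by convention. *)
pose E : R -> Prop := fun x => exists2 n, (r <= n)%N & x = ex_density R F n.
have lbE : classical_sets.has_lbound E.
  by exists 0 => _ [n _ ->]; rewrite /ex_density divr_ge0 ?ler0n.
have [|x [m rm ->] xlt] := @inf_adherent R E eps eps0.
  by split=> //; exists (ex_density R F r), r.
exists m => // n rn; apply: lt_le_trans xlt _; rewrite lerD2r.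
by apply: ge_inf => //; exists n.
Qed.

Lemma ex_T_le {r : nat} {J : {group 'S_r}} (F F' : tgraph J -> Prop) (n : nat) :
  (forall G : tgraph_on J 'I_n, family_free F G -> family_free F' G) ->
  (ex_T n F <= ex_T n F')%N.
Proof.
move=> FF'; apply/bigmax_leqP => G /asboolP GF.
by apply: leq_bigmax_cond; apply/asboolP/FF'.
Qed.

Lemma finite_subfamily {r : nat} {J : {group 'S_r}} (F : tgraph J -> Prop) (m : nat) :
  exists F' : tgraph J -> Prop, [/\ finite_family F', forall H, F' H -> F H &
    forall G : tgraph_on J 'I_m, family_free F' G -> family_free F G].
Proof.
(* [tgraph_on J 'I_m] is a finite type, hence so is [bad], whose enumeration will index the chosen
   members of [F]. *)
pose bad := {G : tgraph_on J 'I_m | ~~ `[< family_free F G >]}.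
have : forall G : bad, exists H : tgraph J, F H /\
    exists f : vertices H -> 'I_m, is_copy (structure H) (val G) f.
  move=> [G /= /asboolP nG]; apply: contrapT => noH; apply: nG => H FH cH.
  by apply: noH; exists H.
case/choice => w wP.
exists (fun H => exists G : bad, H = w G); split.
- exists #|{: bad}|, (fun i => w (enum_val i)) => H; split=> [[G ->]|[i ->]].
    by exists (enum_rank G); rewrite enum_rankK.
  by exists (enum_val i).
- by move=> _ [G ->]; have [] := wP G.
- move=> G GF'; apply: contrapT => /asboolPn nG.
  have [_ cG] := wP (exist _ G nG).
  by apply: (GF' _ _ cG); exists (exist _ G nG).
Qed.

Lemma bin_le_expn (n k : nat) : ('C(n, k) <= n ^ k)%N.
Proof.
apply: (@leq_trans (n ^_ k)); first by rewrite -bin_ffact leq_pmulr ?fact_gt0.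
by elim: k => // k IHk; rewrite ffactnSr expnSr leq_mul // leq_subr.
Qed.

Theorem mainTheorem15 (R : realType) (r : nat) (hr : (2 <= r)%N)
    (J : {group 'S_r}) (F : tgraph J -> Prop) (hF : ~ finite_family F)
    (eps : R) (heps : 0 < eps) :
  exists Feps : tgraph J -> Prop,
    [/\ finite_family Feps,
        forall H : tgraph J, Feps H -> F H &
        exists N : nat, forall n : nat, (N <= n)%N ->
          (ex_T n F <= ex_T n Feps)%N /\
          (ex_T n Feps)%:R < (ex_T n F)%:R + eps * n%:R ^+ r].
Proof.
have [m rm mP] := ex_density_stable R F eps heps.
have [Feps [finF subF mF]] := finite_subfamily F m.
exists Feps; split=> //; exists m => n mn; split.
  by apply: ex_T_le => G GF H /subF; apply: GF.
have rn := leq_trans rm mn.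
have C0 : 0 < 'C(n, r)%:R :> R by rewrite ltr0n bin_gt0.
(* Go down to [m], where [Feps] has density at most that of [F], and return to [n] at a cost below
   [eps]. *)
have lt_density : ex_density R Feps n < ex_density R F n + eps.
  apply: le_lt_trans (ex_density_le R Feps m n rm mn) _.
  apply: le_lt_trans (mP n rn); rewrite ler_pM2r ?invr_gt0 ?ltr0n ?bin_gt0 //.
  by rewrite ler_nat; apply: ex_T_le.
(* Multiplying by ['C(n, r)] turns densities into edge counts; then ['C(n, r)] is at most
   [n ^ r]. *)
apply: (@lt_le_trans _ _ ((ex_T n F)%:R + eps * 'C(n, r)%:R)).
  by move: lt_density; rewrite -(ltr_pM2r C0) mulrDl !divfK ?gt_eqF.
by rewrite lerD2l ler_pM2l // -natrX ler_nat bin_le_expn.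
Qed.
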